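(* Let $P(X)\in\mathbb{Z}[X]$ be a monic polynomial of degree $d\ge2$ with $P(\mathbb{N}_0)\subseteq\mathbb{N}_0$, and let $\mathcal{S}_{Z,P}=(s_Z(P(n))\bmod 2)_{n\ge0}$, where $s_Z$ is the Zeckendorf sum-of-digits function. Then there is a constant $c>0$ depending only on $P$ such that \[ M(\mathcal{S}_{Z,P},N)\ \ge\ c\,N^{1/(2d)} \] for all sufficiently large $N$, where $M(\mathcal{S},N)$ denotes the $N$th maximum order complexity.
   Context: $\mathbb{N}_0=\{0,1,2,\dots\}$. Fibonacci numbers: $F_0=0$, $F_1=1$, $F_{n+2}=F_{n+1}+F_n$. Every integer $n\ge 0$ has a unique Zeckendorf representation $n=\sum_{i\ge0}\varepsilon_i(n)F_{i+2}$ with $\varepsilon_i(n)\in\{0,1\}$ and $\varepsilon_i(n)\varepsilon_{i+1}(n)=0$ for all $i$; set $s_Z(n)=\sum_{i\ge0}\varepsilon_i(n)$. Maximum order complexity: for a binary sequence $\mathcal{S}=(s_n)_{n\ge0}$ over $\{0,1\}=\mathbb{F}_2$ and an integer $N\ge2$ with $(s_0,\dots,s_{N-2})$ not constant, $M(\mathcal{S},N)$ is the smallest positive integer $M$ such that there is a polynomial $f\in\mathbb{F}_2[x_1,\dots,x_M]$ with $s_{i+M}=f(s_i,\dots,s_{i+M-1})$ for all $0\le i\le N-M-1$. If $s_0=\dots=s_{N-2}=a$, then $M(\mathcal{S},N)=0$ if $s_{N-1}=a$ and $M(\mathcal{S},N)=N-1$ otherwise. *)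

(* Defs.v *)
From HB Require Import structures.
From mathcomp Require Import all_boot all_order all_algebra.
From mathcomp Require Import zify.
From mathcomp Require Import boolp mpoly.

Set Implicit Arguments.
Unset Strict Implicit.
Unset Printing Implicit Defensive.

Import GRing.Theory.

Fixpoint fib (n : nat) : nat :=
  if n is n'.+1 then (if n' is n''.+1 then fib n'' + fib n' else 1) else 0.
Arguments fib n : simpl never.

Definition is_zeckendorf (n : nat) (e : nat -> bool) : Prop :=
  (forall i, ~~ (e i && e i.+1)) /\
  exists K, (forall i, K <= i -> e i = false) /\
            n = \sum_(i < K) e i * fib i.+2.

(* Greedy digits of index < k; they represent n as soon as n < fib k.+2. *)
Fixpoint greedy_digits (k n : nat) : nat -> bool :=
  if k is k'.+1 then
    if fib k'.+2 <= n
    then fun i => (i == k') || greedy_digits k' (n - fib k'.+2) i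
    else greedy_digits k' n
  else fun=> false.

Definition zdigit (n : nat) : nat -> bool := greedy_digits n n.

(* Digits of index i >= n vanish, see zdigit_out. *)
Definition sZ (n : nat) : nat := \sum_(i < n) zdigit n i.

Lemma fibSS n : fib n.+2 = fib n + fib n.+1.
Proof. by []. Qed.

Lemma ltn_fib n : n < fib n.+2.
Proof.
have fib_gt0 m : 0 < fib m.+1 by elim: m => // m IHm; rewrite fibSS; lia.
by elim: n => // n IHn; rewrite fibSS; have := fib_gt0 n; lia.
Qed.

Lemma greedy_digits_out k n i : k <= i -> greedy_digits k n i = false.
Proof.
elim: k n => //= k IHk n lt_ki.
by case: ifP => _; rewrite IHk ?(ltnW lt_ki) // orbF; apply/eqP; lia.
Qed.

Lemma greedy_digitsS k n : greedy_digits k.+1 n =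
  if fib k.+2 <= n
  then fun i => (i == k) || greedy_digits k (n - fib k.+2) i
  else greedy_digits k n.
Proof. by []. Qed.

Lemma greedy_digits_spec k n : n < fib k.+2 ->
  (forall i, ~~ (greedy_digits k n i && greedy_digits k n i.+1)) /\
  n = \sum_(i < k) greedy_digits k n i * fib i.+2.
Proof.
elim: k n => [|k IHk] n.
  by case: n => // _; split=> //; rewrite big_ord0.
rewrite [fib k.+3]fibSS greedy_digitsS => ltn.
case: (leqP (fib k.+2) n) => [le_Fn | lt_nF].
  have [|nadj nE] := IHk (n - fib k.+2); first by move: (fibSS k); lia.
  split=> [i|].
    case: (eqVneq i k) => [->|neq_ik] /=.
      by rewrite greedy_digits_out // orbF; apply/eqP; lia.
    case: (eqVneq i.+1 k) => [ik|] /=; last by move=> _; apply: nadj.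
    rewrite andbT -ik greedy_digitsS ifN; first by rewrite greedy_digits_out.
    by rewrite -ltnNge ik; lia.
  rewrite big_ord_recr /= eqxx mul1n.
  rewrite (eq_bigr (fun i : 'I_k =>
    greedy_digits k (n - fib k.+2) i * fib i.+2)) => [|i _]; first by rewrite -nE subnK.
  by rewrite /= (ltn_eqF (ltn_ord i)).
have [nadj nE] := IHk n lt_nF; split=> //.
by rewrite big_ord_recr /= greedy_digits_out // addn0.
Qed.

Lemma zdigitP n : is_zeckendorf n (zdigit n).
Proof.
have [nadj nE] := greedy_digits_spec (ltn_fib n).
split=> //; exists n; split=> // i; exact: greedy_digits_out.
Qed.

Lemma zdigit_out n i : n <= i -> zdigit n i = false.
Proof. exact: greedy_digits_out. Qed.

Lemma ltn_zeckendorf_sum (e : nat -> bool) K :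
  (forall i, ~~ (e i && e i.+1)) -> \sum_(i < K) e i * fib i.+2 < fib K.+2.
Proof.
move=> nadj; suff [] : \sum_(i < K) e i * fib i.+2 < fib K.+2 /\
  \sum_(i < K.+1) e i * fib i.+2 < fib K.+3 by [].
elim: K => [|K [IH1 IH2]].
  by split; rewrite ?big_ord_recr big_ord0 //=; case: (e 0).
split=> //; rewrite big_ord_recr /= [fib K.+4]fibSS.
case eK1: (e K.+1); last by rewrite mul0n addn0 ltn_addl.
have eK : e K = false by move: (nadj K); rewrite eK1 andbT => /negPf.
by rewrite big_ord_recr /= eK mul0n addn0 mul1n ltn_add2r.
Qed.

Lemma zeckendorf_uniq n e1 e2 :
  is_zeckendorf n e1 -> is_zeckendorf n e2 -> e1 =1 e2.
Proof.
move=> [nadj1 [K1 [out1 n1]]] [nadj2 [K2 [out2 n2]]].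
have widen (e : nat -> bool) K L : (forall i, K <= i -> e i = false) ->
    K <= L -> \sum_(i < L) e i * fib i.+2 = \sum_(i < K) e i * fib i.+2.
  move=> out; elim: L => [|L IHL]; first by rewrite leqn0 => /eqP->.
  rewrite leq_eqVlt => /predU1P[<- //|le_KL].
  by rewrite big_ord_recr /= out // addn0 IHL.
move: n2; rewrite n1 -(widen _ _ _ out1 (leq_maxl K1 K2)).
rewrite -(widen _ _ _ out2 (leq_maxr K1 K2)) => eqS i.
have out : forall j, maxn K1 K2 <= j -> e1 j = e2 j.
  by move=> j; rewrite geq_max => /andP[? ?]; rewrite out1 ?out2.
case: (leqP (maxn K1 K2) i) => [/out //|].
move: (maxn K1 K2) eqS => K {n1 out out1 out2 widen}; elim: K => // K IHK.
rewrite !big_ord_recr /=.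
have := ltn_zeckendorf_sum K nadj1; have := ltn_zeckendorf_sum K nadj2.
move: IHK; set s1 := \sum_(_ < K) e1 _ * _; set s2 := \sum_(_ < K) e2 _ * _.
move: s1 s2 => s1 s2 IHK; case E1: (e1 K); case E2: (e2 K); rewrite ?mul1n ?mul0n ?addn0;
  [ move=> _ _ /addIn eqS | lia | lia | move=> _ _ eqS ];
by rewrite ltnS leq_eqVlt => /predU1P[->|]; [rewrite E1 E2 | apply: IHK].
Qed.

Local Open Scope ring_scope.

Definition satisfies_recurrence (S : nat -> 'F_2) (N M : nat) : Prop :=
  exists f : {mpoly 'F_2[M]}, forall i : nat, (i + M < N)%N ->
    S (i + M)%N = f.@[fun j : 'I_M => S (i + j)%N].

Lemma recurrence_exists (S : nat -> 'F_2) (N : nat) :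
  exists M, (0 < M)%N && `[< satisfies_recurrence S N M >].
Proof.
exists N.+1; apply/andP; split=> //; apply/asboolP; exists 0 => i; lia.
Qed.

(* For N < 2 the notion is not defined and the value here is the junk 0. *)
Definition max_order_complexity (S : nat -> 'F_2) (N : nat) : nat :=
  if [forall i : 'I_N.-1, S i == S 0%N]
  then (if S N.-1 == S 0%N then 0%N else N.-1)
  else ex_minn (recurrence_exists S N).

(* %:R into 'F_2 is reduction mod 2; absz is only meant for P(n) >= 0. *)
Definition zeckendorf_seq (P : {poly int}) (n : nat) : 'F_2 :=
  (sZ `|P.[n%:Z]|%N)%:R.

(* Main.v *)
Require Import Defs.
From mathcomp Require Import all_boot all_order all_algebra.
From mathcomp Require Import realalg boolp mpoly reals exp.
From mathcomp Require Import zify ring lra.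

(* Write alpha for the golden ratio, L_n for the Lucas numbers, and let k be
   even, so that L_{jk} = alpha^{jk} + alpha^{-jk}. If tau is an integer
   combination of L_k, L_{2k}, ..., then P(u + tau) = W_0(u) + sum_{j >= 1}
   W_j(u) L_{jk}, where the polynomials W_j do not depend on k. As long as 0
   <= W_j(u) <= fib g and k >= 2 (g + 6), the Zeckendorf digits of the blocks
   W_j(u) L_{jk} do not interfere and are translated rigidly when k varies, so
   the digit sum does not depend on k.

   With tau = L_k this gives equal windows at L_k, L_{k+2} and L_{k+4}, of
   length about N^{1/(2d)} when L_k is about N. A recurrence of order at most
   the window length then makes L_{k+1} and L_{k+3} periods of the sequence
   from there on; by the Fibonacci recursion all smaller Lucas numbers are
   periods as well, down to L_1 = 1, so the sequence is constant on a long
   range. With tau = L_{3k} + 2 L_{2k} - L_k and u large, W_1(u) is the only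
   negative coefficient; the borrow it causes fills the gap between two blocks
   with digits, one more for k + 2 than for k, so the sequence is not constant
   on that range. *)

Set Implicit Arguments.
Unset Strict Implicit.
Unset Printing Implicit Defensive.
Import Order.TTheory GRing.Theory Num.Theory.

(** * Fibonacci and Lucas numbers *)

Fixpoint lucas (n : nat) : nat :=
  if n is n'.+1 then (if n' is n''.+1 then lucas n'' + lucas n' else 1) else 2.
Arguments lucas n : simpl never.

Lemma lucasSS n : lucas n.+2 = lucas n + lucas n.+1.
Proof. by []. Qed.

Lemma fib_rec_ind (P : nat -> Prop) :
  P 0 -> P 1 -> (forall n, P n -> P n.+1 -> P n.+2) -> forall n, P n.
Proof.
move=> P0 P1 PSS n; suff [] : P n /\ P n.+1 by [].
by elim: n => // n [IH1 IH2]; split; last exact: PSS.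
Qed.

Lemma fib_gt0 n : 0 < fib n.+1.
Proof. by elim: n => // n IHn; rewrite fibSS; lia. Qed.

Lemma leq_fib m n : m <= n -> fib m <= fib n.
Proof.
move=> /subnKC <-; elim: (n - m) => [|k IHk]; first by rewrite addn0.
by rewrite addnS (leq_trans IHk) //; case: (m + k) => // j; rewrite fibSS leq_addl.
Qed.

Lemma fib_inj_lt m n : fib m < fib n -> m < n.
Proof. by rewrite !ltnNge; apply: contra => /leq_fib. Qed.

Lemma lucas_gt0 n : 0 < lucas n.
Proof. by elim/fib_rec_ind: n => // n ? ?; rewrite lucasSS; lia. Qed.

Lemma ltn_lucas m n : 0 < m -> m < n -> lucas m < lucas n.
Proof.
case: m => // m _ lt_mn; rewrite -(subnKC lt_mn).
elim: (n - m.+2) => [|k IHk]; first by rewrite addn0 lucasSS; have := lucas_gt0 m; lia.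
by rewrite addnS (leq_trans IHk) // addSn lucasSS leq_addl.
Qed.

Lemma leq_lucas m n : 0 < m -> m <= n -> lucas m <= lucas n.
Proof. by move=> m0; rewrite leq_eqVlt => /predU1P[->//|/(ltn_lucas m0)/ltnW]. Qed.

Lemma leq_lucas_id n : n <= lucas n.
Proof. by elim: n => // -[//|n] IHn; rewrite lucasSS; have := lucas_gt0 n; lia. Qed.

Lemma lucasE n : lucas n + fib n = 2 * fib n.+1.
Proof.
by elim/fib_rec_ind: n => // n IH1 IH2; rewrite lucasSS !(fibSS n, fibSS n.+1) in IH1 IH2 *; lia.
Qed.

(** Only [lucas 0 = 2] exceeds its bound [fib 2 = 1], whence the correction term. *)
Lemma lucas_le_fib n : lucas n <= fib n.+2 + (n == 0).
Proof.
elim/fib_rec_ind: n => // n IH1 IH2; rewrite lucasSS fibSS.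
case: n => [|n] //= in IH1 IH2 *; lia.
Qed.

Lemma fib_mul_le a b : fib a * fib b.+1 <= fib (a + b).
Proof.
elim/fib_rec_ind: a => [|//|a IH1 IH2]; first by rewrite mul0n.
- by rewrite mul1n.
by rewrite fibSS mulnDl !addSn fibSS leq_add.
Qed.

(** This controls the width of a block: a coefficient up to [fib a] costs at most [a + 1] further
    indices. *)
Lemma fib_mul_lucas a n : 0 < n -> fib a * lucas n <= fib (a + n.+1).
Proof.
move=> n0; apply: leq_trans (fib_mul_le _ _).
by rewrite leq_mul2l (leq_trans (lucas_le_fib _)) ?orbT // eqn0Ngt n0 addn0.
Qed.

Lemma fib_double a b : fib (a + b).+1 = fib a * fib b + fib a.+1 * fib b.+1.
Proof.
elim/fib_rec_ind: a => [|//|a IH1 IH2].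
- by rewrite mul0n add0n mul1n.
- by rewrite !mul1n.
by rewrite !addSn fibSS IH1 -addSn IH2 !fibSS !mulnDl; lia.
Qed.

Lemma fib_telescope q s : fib (q + 2 * s) = fib q + \sum_(i < s) fib (q.+1 + 2 * i).
Proof.
elim: s => [|s IHs]; first by rewrite big_ord0 muln0 !addn0.
rewrite big_ord_recr /= addnA -IHs mulnS addnCA add2n fibSS addSn; lia.
Qed.

(** * Zeckendorf expansions as lists of Fibonacci indices *)

(** The entries are Fibonacci indices: the entry [i.+2] is the digit position [i] of [zdigit],
    whence the lower bound 2 in [zlist]. *)
Definition gapped (l : seq nat) := pairwise (fun i j => i.+1 < j) l.
Definition zlist (l : seq nat) := gapped l && all (leq 2) l.
Definition fibsum (l : seq nat) := \sum_(i <- l) fib i.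

Lemma gapped_mem l x y : gapped l -> x \in l -> y \in l ->
  [|| x == y, x.+1 < y | y.+1 < x].
Proof.
elim: l => // a l IHl /= /andP[/allP ha hl]; rewrite !inE.
case/predU1P=> [->|xl] /predU1P[->|yl].
- by rewrite eqxx.
- by rewrite (ha y yl) orbT.
- by rewrite (ha x xl) !orbT.
- exact: IHl.
Qed.

Lemma gapped_uniq l : gapped l -> uniq l.
Proof.
elim: l => // a l IHl /= /andP[/allP ha /IHl ->]; rewrite andbT.
by apply/negP => /ha; rewrite ltnNge leqnSn.
Qed.

Lemma gapped_cat l1 l2 b : gapped l1 -> gapped l2 ->
  all (fun i => i < b) l1 -> all (fun i => b < i) l2 -> gapped (l1 ++ l2).
Proof.
move=> g1 g2 /allP h1 /allP h2; rewrite /gapped pairwise_cat -!/(gapped _) g1 g2 !andbT.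
by apply/allrelP => x y /h1 xb /h2; apply: leq_ltn_trans.
Qed.

Lemma fibsum_cat l1 l2 : fibsum (l1 ++ l2) = fibsum l1 + fibsum l2.
Proof. exact: big_cat. Qed.

Lemma gapped_shift t l : gapped (map (addn t) l) = gapped l.
Proof.
rewrite /gapped pairwise_map; apply: eq_pairwise => i j /=.
by rewrite -addnS ltn_add2l.
Qed.

Lemma fibsum_shift_rec t l : fibsum (map (addn t.+2) l) =
  fibsum (map (addn t) l) + fibsum (map (addn t.+1) l).
Proof.
rewrite /fibsum !big_map -big_split /=; apply: eq_bigr => i _.
by rewrite !addSn fibSS.
Qed.

(** With [f = fib] this gives the value of a list, with [f] constantly 1 its number of digits. *)
Lemma sum_mem_iota (f : nat -> nat) l K : uniq l ->
  (forall i, i \in l -> 1 < i < K.+2) ->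
  \sum_(i < K) (i.+2 \in l) * f i.+2 = \sum_(i <- l) f i.
Proof.
move=> ul hl; rewrite -(big_mkord xpredT (fun i => (i.+2 \in l) * f i.+2)).
rewrite (eq_bigr (fun i => if i.+2 \in l then f i.+2 else 0)); last first.
  by move=> i _; case: ifP; rewrite (mul1n, mul0n).
rewrite -big_mkcond /=.
rewrite -[LHS](big_map (fun i => i.+2) (fun i => i \in l) f) -big_filter.
apply: perm_big; apply: uniq_perm => //.
  by rewrite filter_uniq // map_inj_uniq ?iota_uniq // => i j [].
move=> i; rewrite mem_filter; case il: (i \in l) => //=.
have /andP[i1 iK] := hl i il.
by case: i i1 iK {il} => [|[|i]] // _ iK; rewrite mem_map ?mem_index_iota //; move=> ? ? [].
Qed.

Lemma zlist_is_zeckendorf l : zlist l ->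
  is_zeckendorf (fibsum l) (fun i => i.+2 \in l).
Proof.
case/andP=> gl /allP l2; split=> [i|].
  by apply/negP => /andP[xl yl]; move: (gapped_mem gl xl yl) => /or3P[/eqP||]; lia.
exists (\max_(i <- l) i); split=> [i le_i|].
  apply/negP => il; have h := @leq_bigmax_seq _ l xpredT id _ il isT.
  by have := leq_trans h le_i; rewrite ltnNge leqnSn.
rewrite (sum_mem_iota fib) // ?gapped_uniq // => i il.
rewrite l2 //= ltnS; apply: leqW; exact: (@leq_bigmax_seq _ l xpredT id).
Qed.

Lemma sZ_zlist l : zlist l -> sZ (fibsum l) = size l.
Proof.
move=> zl; have /andP[gl /allP l2] := zl.
have eqd := zeckendorf_uniq (zdigitP _) (zlist_is_zeckendorf zl).
rewrite /sZ -sum1_size -(@sum_mem_iota (fun=> 1) l (fibsum l)) ?gapped_uniq //.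
  by apply: eq_bigr => i _; rewrite eqd muln1.
move=> i il; have i2 := l2 i il; rewrite i2 /=.
case: i i2 il => [|[|i]] // _ il; rewrite !ltnS ltnNge.
by apply/negP => /zdigit_out; rewrite eqd il.
Qed.

Lemma zlist_exists n : exists2 l, zlist l & fibsum l = n.
Proof.
have [n0|] := posnP n; first by exists [::] => //; rewrite n0 /fibsum big_nil.
elim/ltn_ind: n => n IHn n0.
have [j [j2 jn nj]] : exists j, [/\ 1 < j, fib j <= n & n < fib j.+1].
  have ex : exists j, (1 < j) && (fib j <= n) by exists 2.
  have bd j : (1 < j) && (fib j <= n) -> j <= n.+1.
    case/andP=> j1 hj; rewrite -ltnS; apply: fib_inj_lt.
    exact: leq_ltn_trans hj (ltn_fib n).
  case: (ex_maxnP ex bd) => j /andP[j1 hj] jmax; exists j; split=> //.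
  by rewrite ltnNge; apply/negP => h; have := jmax j.+1; rewrite h; lia.
have [eqn|gtn] := posnP (n - fib j).
  exists [:: j]; first by rewrite /zlist /= j2.
  by rewrite /fibsum big_seq1; apply/eqP; rewrite eqn_leq jn -subn_eq0 eqn.
have fj : 0 < fib j by case: j j2 {jn nj gtn} => // j _; apply: fib_gt0.
have [|//|l zl nE] := IHn (n - fib j); first lia.
have /andP[gl /allP l2] := zl.
exists (l ++ [:: j]); last by rewrite fibsum_cat nE /fibsum big_seq1 subnK.
have lb i : i \in l -> i < j.-1.
  move=> il; apply: fib_inj_lt; apply: (@leq_ltn_trans (n - fib j)).
    by rewrite -nE /fibsum (big_rem i) //= leq_addr.
  by case: j j2 jn nj {gtn fj nE} => [|[|j]] // _; have := fibSS j.+1; rewrite /=; lia.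
rewrite /zlist (@gapped_cat _ _ j.-1) //=.
- by rewrite all_cat /= j2 /= andbT; apply/allP.
- by apply/allP.
- by lia.
Qed.

Lemma fibsum_mem_le l i : i \in l -> fib i <= fibsum l.
Proof. by move=> il; rewrite /fibsum (big_rem i) //= leq_addr. Qed.

Lemma zlist_lt l b : fibsum l < fib b -> all (fun i => i < b) l.
Proof.
move=> lb; apply/allP => i /fibsum_mem_le h; apply: fib_inj_lt.
exact: leq_ltn_trans lb.
Qed.

(** * Shifting Zeckendorf expansions *)

Local Open Scope ring_scope.

(** Such an [x] is the inverse of the golden ratio; [1 + x] is the golden ratio and [- x] its
    conjugate. *)
Definition golden (R : realFieldType) (x : R) := 0 < x /\ x ^+ 2 = 1 - x.

Lemma golden_exists (R : rcfType) : exists x : R, golden x.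
Proof.
have s5 : Num.sqrt (5%:R : R) ^+ 2 = 5%:R by rewrite sqr_sqrtr // ler0n.
have s0 : 0 <= Num.sqrt (5%:R : R) := sqrtr_ge0 _.
exists ((Num.sqrt 5%:R - 1) / 2%:R); split; last by field: s5.
by apply: divr_gt0; rewrite ?ltr0n // subr_gt0; nra.
Qed.

Section Golden.
Variables (R : realFieldType) (x : R).
Hypothesis gx : golden x.

Let x_gt0 : 0 < x. Proof. by case: gx. Qed.
Let x_sq : x ^+ 2 = 1 - x. Proof. by case: gx. Qed.
Let x_lt : x < 62%:R / 100%:R.
Proof. by move: x_sq; rewrite expr2 => h; rewrite ltNge; apply/negP => h'; nra. Qed.

Lemma golden_lt1 : x < 1. Proof. by move: x_lt; lra. Qed.

Lemma fib_golden n : (fib n.+1)%:R - (1 + x) * (fib n)%:R = (- x) ^+ n.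
Proof.
elim/fib_rec_ind: n => [||n IH1 IH2].
- by rewrite /fib; ring.
- by rewrite /fib; ring.
have -> : (- x) ^+ n.+2 = (- x) ^+ n + (- x) ^+ n.+1.
  by rewrite !exprS mulrA mulrNN -expr2 x_sq; ring.
by rewrite -IH1 -IH2 !fibSS !natrD; ring.
Qed.

Lemma lucas_golden n : (lucas n)%:R = (1 + x) ^+ n + (- x) ^+ n.
Proof.
elim/fib_rec_ind: n => [||n IH1 IH2]; first by rewrite !expr0.
  by rewrite /lucas; ring.
have h (y : R) : y ^+ 2 = 1 + y -> y ^+ n.+2 = y ^+ n + y ^+ n.+1.
  by move=> yE; rewrite !exprS mulrA -expr2 yE; ring.
rewrite lucasSS natrD IH1 IH2 !h; first by ring.
  by rewrite sqrrN x_sq.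
by ring: x_sq.
Qed.

(** Passing to the next Lucas number is multiplication by the golden ratio up to an error decaying
    like [x ^+ n]. The factor [1 + 2 x] is the square root of 5. *)
Lemma lucas_golden_succ n :
  (lucas n.+1)%:R - (1 + x) * (lucas n)%:R = - (1 + 2%:R * x) * (- x) ^+ n.
Proof. by rewrite !lucas_golden !exprS; ring. Qed.

(** Since [(1 + x) (- x) = - 1], for even [k] the powers [(1 + x) ^+ k] and [(- x) ^+ k] are inverse
    to each other. *)
Lemma lucas_even_mul j k : ~~ odd k ->
  (lucas (j * k))%:R = ((1 + x) ^+ k) ^+ j + ((1 + x) ^+ k)^-1 ^+ j.
Proof.
move=> ek; rewrite lucas_golden mulnC !exprM; congr (_ + _ ^+ _).
have a0 : (1 + x) ^+ k != 0 by rewrite expf_neq0 // lt0r_neq0 // addr_gt0 ?ltr01.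
apply: (mulfI a0); rewrite mulfV // -exprMn.
have -> : (1 + x) * - x = - 1 by ring: x_sq.
by rewrite -signr_odd (negPf ek) expr0.
Qed.

(** The tail beyond an entry [i] is below [x ^+ i.+1] because of the gap, and [x ^+ i + x ^+ i.+1]
    collapses to [x ^+ i.-1]. *)
Lemma gapped_geometric l a : gapped l -> all (fun i => (a < i)%N) l ->
  \sum_(i <- l) x ^+ i < x ^+ a.
Proof.
elim: l a => [|i l IHl] a /=; first by rewrite big_nil exprn_gt0.
case/andP=> hi gl /andP[ai _]; rewrite big_cons.
have h := IHl i.+1 gl hi.
apply: (@lt_le_trans _ _ (x ^+ i + x ^+ i.+1)); first by rewrite ltrD2l.
case: i ai {h hi} => // i; rewrite ltnS => ai.
have -> : x ^+ i.+1 + x ^+ i.+2 = x ^+ i.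
  by rewrite -[i.+2]addn2 exprD x_sq exprS; ring.
by rewrite ler_wiXn2l ?ltW // golden_lt1.
Qed.

(* [fib i.+1 - (1 + x) * fib i = (- x) ^+ i], so the shifted sum is the only
   integer at distance less than 1 from [x1]. *)
Lemma fibsum_shift1 l (x1 : nat) : zlist l ->
  `|x1%:R - (1 + x) * (fibsum l)%:R| <= 1 - x -> fibsum (map S l) = x1.
Proof.
case/andP=> gl l2 hx1.
have hD : `|(fibsum (map S l))%:R - (1 + x) * (fibsum l)%:R| < x.
  rewrite /fibsum big_map !natr_sum mulr_sumr -sumrB.
  apply: (@le_lt_trans _ _ (\sum_(i <- l) x ^+ i)).
    apply: le_trans (ler_norm_sum _ _ _) _; apply: ler_sum => i _.
    by rewrite fib_golden normrX normrN gtr0_norm.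
  by have := @gapped_geometric l 1 gl l2; rewrite expr1.
have : `|(fibsum (map S l))%:R - x1%:R| < (1 : R).
  rewrite (_ : _ - _ = ((fibsum (map S l))%:R - (1 + x) * (fibsum l)%:R)
     - (x1%:R - (1 + x) * (fibsum l)%:R)); last ring.
  by apply: le_lt_trans (ler_normB _ _) _; lra.
rewrite ltr_norml ltrBlDr ltrBrDr ![_ + x1%:R]addrC => /andP[].
have -> : (x1%:R - 1 < (fibsum (map S l))%:R :> R) = (x1 < (fibsum (map S l)).+1)%N.
  by rewrite ltrBlDr natr1 ltr_nat.
by rewrite natr1 ltr_nat; lia.
Qed.

(** Both sides obey the Fibonacci recursion in [t], so agreement at 0 and 1 suffices, and
    [fibsum_shift1] gives the latter. This is the rigid translation of digits. *)
Lemma fibsum_shift (G : nat -> nat) l : zlist l ->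
  (forall t, G t.+2 = G t + G t.+1)%N -> fibsum l = G 0%N ->
  `|(G 1%N)%:R - (1 + x) * (G 0%N)%:R| <= 1 - x ->
  forall t, fibsum (map (addn t) l) = G t.
Proof.
move=> zl GSS G0 G1; elim/fib_rec_ind => [||t IH1 IH2].
- by rewrite -G0; congr fibsum; rewrite -[RHS]map_id; apply: eq_map.
- by rewrite -(fibsum_shift1 zl (x1 := G 1%N)) // G0.
- by rewrite fibsum_shift_rec IH1 IH2 GSS.
Qed.

(** As [x ^+ 2 = 1 - x], each value is a convex combination, with weights [1 - x] and [x], of the
    two before it. *)
Lemma fib_golden_le1 n : (fib n)%:R * x ^+ n <= 1.
Proof.
elim/fib_rec_ind: n => [||n IH1 IH2].
- by rewrite mul0r ler01.
- by rewrite mul1r expr1 ltW // golden_lt1.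
rewrite fibSS natrD; have -> : ((fib n)%:R + (fib n.+1)%:R) * x ^+ n.+2 =
   (1 - x) * ((fib n)%:R * x ^+ n) + x * ((fib n.+1)%:R * x ^+ n.+1).
  by rewrite -x_sq !exprS; ring.
move: golden_lt1 x_gt0 IH1 IH2; move: (_ * x ^+ n) (_ * x ^+ n.+1) => A B x1 x0 A1 B1.
have : (1 - x) * A <= (1 - x) * 1 by rewrite ler_wpM2l // subr_ge0 ltW.
have : x * B <= x * 1 by rewrite ler_wpM2l // ltW.
move: x_lt; lra.
Qed.

(** The offset 6 is fixed here: [(1 + 2 x) x ^ 6 = 18 x - 11] is about 0.125, which leaves room
    below the tolerance [1 - x], about 0.38, for the further [x ^ 6] in [borrow_block]. *)
Let golden_error g (a : nat) : (a <= fib g)%N ->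
  a%:R * (1 + 2%:R * x) * x ^+ (g + 6) <= 18%:R * x - 11%:R.
Proof.
move=> ag; have x6 : (1 + 2%:R * x) * x ^+ 6 = 18%:R * x - 11%:R by ring: x_sq.
have -> : a%:R * (1 + 2%:R * x) * x ^+ (g + 6) =
   (a%:R * x ^+ g) * (18%:R * x - 11%:R) by rewrite -x6 exprD; ring.
apply: ler_piMl; first by rewrite -x6 mulr_ge0 ?exprn_ge0 ?addr_ge0 ?mulr_ge0 ?ltW.
apply: le_trans (fib_golden_le1 g).
by rewrite ler_wpM2r ?exprn_ge0 ?ler_nat // ltW.
Qed.

Let golden_norm (a n : nat) :
  `|a%:R * (- (1 + 2%:R * x) * (- x) ^+ n)| = a%:R * (1 + 2%:R * x) * x ^+ n.
Proof.
rewrite !normrM normrN normrX normrN (gtr0_norm x_gt0) ger0_norm ?ler0n //.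
by rewrite gtr0_norm ?mulrA //; move: x_gt0; lra.
Qed.

Lemma lucas_block g (a : nat) l : (a <= fib g)%N -> zlist l ->
  fibsum l = (a * lucas (g + 6))%N ->
  forall t, fibsum (map (addn t) l) = (a * lucas (g + 6 + t))%N.
Proof.
move=> ag zl lE; apply: (@fibsum_shift (fun t => a * lucas (g + 6 + t))%N) => //.
- by move=> t; rewrite !addnS lucasSS mulnDr.
- by rewrite addn0.
rewrite addn0 addn1 !natrM mulrCA -mulrBr lucas_golden_succ.
by rewrite golden_norm; apply: le_trans (golden_error ag) _; move: x_lt; lra.
Qed.

(** A difference of two solutions of the Fibonacci recursion is again one; [g < r] makes the
    truncated subtraction exact for every [t]. *)
Lemma borrow_block g (a r : nat) l : (a <= fib g)%N -> (g < r)%N -> zlist l ->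
  fibsum l = (fib (g + 6 + r) - a * lucas (g + 6))%N ->
  forall t, fibsum (map (addn t) l) =
    (fib (g + 6 + r + t) - a * lucas (g + 6 + t))%N.
Proof.
move=> ag gr zl lE.
have le t : (a * lucas (g + 6 + t) <= fib (g + 6 + r + t))%N.
  apply: (@leq_trans (fib g * lucas (g + 6 + t))); first by rewrite leq_mul2r ag orbT.
  by apply: leq_trans (@fib_mul_lucas _ _ _) _; [lia | apply: leq_fib; lia].
apply: (@fibsum_shift (fun t => fib (g + 6 + r + t) - a * lucas (g + 6 + t))%N) => //.
- move=> t; have := le t; have := le t.+1; rewrite !addnS fibSS lucasSS mulnDr.
  by move: (a * _)%N (a * _)%N => b c; lia.
- by rewrite !addn0.
have := le 0%N; have := le 1%N; rewrite !addn0 !addn1 => le1 le0.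
rewrite !natrB // !natrM.
have -> : (fib (g + 6 + r).+1)%:R - a%:R * (lucas (g + 6).+1)%:R -
   (1 + x) * ((fib (g + 6 + r))%:R - a%:R * (lucas (g + 6))%:R) =
   ((fib (g + 6 + r).+1)%:R - (1 + x) * (fib (g + 6 + r))%:R) -
    a%:R * ((lucas (g + 6).+1)%:R - (1 + x) * (lucas (g + 6))%:R) :> R by ring.
rewrite fib_golden lucas_golden_succ.
apply: le_trans (ler_normB _ _) _.
rewrite golden_norm normrX normrN gtr0_norm //; have h1 := golden_error ag.
have h2 : x ^+ (g + 6 + r) <= x ^+ 6.
  by rewrite ler_wiXn2l ?ltW ?golden_lt1 //; lia.
have x6 : x ^+ 6 = 5%:R - 8%:R * x by ring: x_sq.
move: x_lt; lra.
Qed.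

End Golden.

(** * Digit sums of combinations of Lucas numbers *)

Local Open Scope nat_scope.

Lemma zlist_cat l1 l2 b : zlist l1 -> zlist l2 ->
  all (fun i => i < b) l1 -> all (fun i => b < i) l2 -> zlist (l1 ++ l2).
Proof.
case/andP=> g1 h1 /andP[g2 h2] b1 b2.
by rewrite /zlist (gapped_cat g1 g2 b1 b2) all_cat h1.
Qed.

Lemma zlist_shift t l : zlist l -> zlist (map (addn t) l).
Proof.
case/andP=> gl /allP l2; rewrite /zlist gapped_shift gl /= all_map.
by apply/allP => i /l2 h; rewrite /= (leq_trans h) ?leq_addl.
Qed.

Lemma zlist_small g a : a <= fib g ->
  exists l, [/\ zlist l, fibsum l = a & all (fun i => i < g.+2) l].
Proof.
have [l zl lE] := zlist_exists a => ag; exists l; split=> //; apply: zlist_lt.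
by rewrite lE fibSS; have := fib_gt0 g; lia.
Qed.

Lemma lucas_zlist g a : a <= fib g -> exists l, [/\ zlist l,
  all (fun i => i < 2 * g + 8) l,
  size l = sZ (a * lucas (g + 6)) &
  forall t, fibsum (map (addn t) l) = a * lucas (g + 6 + t)].
Proof.
have [x gx] := golden_exists realalg => ag.
have [l zl lE] := zlist_exists (a * lucas (g + 6)).
exists l; split=> //; last exact: (lucas_block gx ag zl lE).
  apply: zlist_lt; rewrite lE.
  apply: (@leq_ltn_trans (fib (2 * g + 7))); last first.
    have -> : 2 * g + 8 = (2 * g + 5).+3 by lia.
    have -> : 2 * g + 7 = (2 * g + 5).+2 by lia.
    by rewrite [fib _.+3]fibSS; have := fib_gt0 (2 * g + 5); lia.
  apply: (@leq_trans (fib g * lucas (g + 6))); first by rewrite leq_mul2r ag orbT.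
  apply: leq_trans (@fib_mul_lucas _ _ _) _; first lia.
  by apply: leq_fib; lia.
by rewrite -lE sZ_zlist.
Qed.

(** The translated block has its indices between [j.+1 * k - g - 4] and [j.+1 * k + g + 1]; for
    [k >= 2 (g + 6)] this lies beyond [j * k + g + 2]. *)
Lemma append_block g k j l0 a : a <= fib g -> 2 * (g + 6) <= k ->
  zlist l0 -> all (fun i => i < j * k + g.+2) l0 ->
  exists l, [/\ zlist l, all (fun i => i < j.+1 * k + g.+2) l,
    fibsum l = fibsum l0 + a * lucas (j.+1 * k) &
    size l = size l0 + sZ (a * lucas (g + 6))].
Proof.
move=> ag gk z0 b0; have [l [zl bl sl lE]] := lucas_zlist ag.
have /andP[_ /allP l2] := zl.
exists (l0 ++ map (addn (j.+1 * k - (g + 6))) l); split.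
- apply: (zlist_cat (b := j * k + g.+2)) => //; first exact: zlist_shift.
  by apply/allP => _ /mapP[i il ->]; have := l2 i il; rewrite mulSn /=; lia.
- rewrite all_cat; apply/andP; split.
    by apply: sub_all b0 => i; rewrite mulSn; lia.
  by apply/allP => _ /mapP[i /(allP bl) il ->]; rewrite mulSn /= in il *; lia.
- by rewrite fibsum_cat lE subnKC // mulSn; lia.
- by rewrite size_cat size_map sl.
Qed.

Lemma append_blocks g k j l0 (w : nat -> nat) : (forall i, w i <= fib g) ->
  2 * (g + 6) <= k -> zlist l0 -> all (fun i => i < j * k + g.+2) l0 ->
  forall D, exists l, [/\ zlist l, all (fun i => i < (j + D) * k + g.+2) l,
    fibsum l = fibsum l0 + \sum_(i < D) w i * lucas ((j + i.+1) * k) &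
    size l = size l0 + \sum_(i < D) sZ (w i * lucas (g + 6))].
Proof.
move=> wg gk z0 b0; elim=> [|D [l [zl bl lE sl]]].
  by exists l0; rewrite !big_ord0 !addn0.
have [l' [zl' bl' lE' sl']] := append_block (wg D) gk zl bl.
exists l'; rewrite !big_ord_recr /= !addnA -lE -sl [j + _]addnS; split=> //; rewrite ?lE' ?addnS //.
Qed.

(** The point is that the right-hand side does not contain [k]. *)
Lemma sZ_blocks g k w0 (w : nat -> nat) D : w0 <= fib g ->
  (forall i, w i <= fib g) -> 2 * (g + 6) <= k ->
  sZ (w0 + \sum_(i < D) w i * lucas (i.+1 * k)) =
  sZ w0 + \sum_(i < D) sZ (w i * lucas (g + 6)).
Proof.
move=> w0g wg gk; have [l0 [z0 e0 b0]] := zlist_small w0g.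
have [|l [zl _ lE sl]] := @append_blocks g k 0 l0 w wg gk z0 _ D; first by rewrite mul0n.
under eq_bigr do rewrite -[_.+1]add0n.
by rewrite -e0 -lE !sZ_zlist.
Qed.

Lemma filler_zlist q s : zlist [seq q.+2 + 2 * i | i <- iota 0 s].
Proof.
apply/andP; split; last by rewrite all_map; apply/allP => i _ /=; rewrite !addSn.
rewrite /gapped pairwise_map.
have : pairwise ltn (iota 0 s) by rewrite -(sorted_pairwise ltn_trans) iota_ltn_sorted.
by apply: sub_pairwise => i j /=; lia.
Qed.

(* The negative block [- v * lucas k] borrows the lowest Fibonacci number
   [fib p] of the block [w2 * lucas (2 * k)]; writing
   [fib p = fib q + fib q.+1 + fib q.+3 + ... + fib p.-1], the gap between the
   two blocks is filled with [(p - q) / 2] new digits. *)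
Lemma sZ_borrow g w0 v w2 (w : nat -> nat) D : w0 <= fib g -> v <= fib g ->
  w2 <= fib g -> (forall i, w i <= fib g) -> 0 < v -> 0 < w2 ->
  exists c, forall j, g + 6 <= j ->
    sZ (w0 + (w2 * lucas (2 * (2 * j)) - v * lucas (2 * j)) +
      \sum_(i < D) w i * lucas (i.+3 * (2 * j))) = c + (j - (g + 6)).
Proof.
move=> w0g vg w2g wg v0 w20.
have [x gx] := golden_exists realalg.
have [l0 [z0 e0 b0]] := zlist_small w0g.
have [l2 [z2 b2 _ l2E]] := lucas_zlist w2g.
case: l2 z2 b2 l2E => [|a l2] z2 b2 l2E.
  have := l2E 0; rewrite /fibsum big_nil => /esym/eqP.
  by rewrite muln_eq0 !eqn0Ngt w20 lucas_gt0.
have /andP[/andP[/allP a_l2 g2] /andP[a2 ge2]] := z2.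
have /andP[ab /allP b2'] := b2.
(* Here [a] is the lowest index of the untranslated upper block. This [r] makes
   [p - q = k - 2 (g + 6) = 2 s] below, independently of [a], so that exactly [s] filling digits
   appear. *)
pose r := g + 6 + a.
have [l1 z1 l1E] := zlist_exists (fib (g + 6 + r) - v * lucas (g + 6)).
have {}l1E' := borrow_block gx vg _ z1 l1E.
have gr : g < r by rewrite /r; lia.
have {}l1E' := l1E' gr.
have /andP[_ /allP ge1] := z1.
have b1 : all (fun i => i < g + 6 + r) l1.
  apply: zlist_lt; rewrite l1E ltn_subrL muln_gt0 v0 lucas_gt0 /=.
  have -> : g + 6 + r = (g + 5 + r).+1 by lia.
  exact: fib_gt0.
pose s0 := size l0 + size l1 + size l2 + \sum_(i < D) sZ (w i * lucas (g + 6)).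
exists s0 => j hj; set k := 2 * j; set s := j - (g + 6).
pose q := k + r; pose p := 2 * k - (g + 6) + a.
have pE : p = q + 2 * s by rewrite /p /q /r /s /k; clear -hj; lia.
have q2 : q = q.-2.+2 by rewrite /q /r; clear; lia.
pose fl := [seq q.-2.+2.+1 + 2 * i | i <- iota 0 s].
have flE : fib p = fib q + fibsum fl.
  by rewrite pE fib_telescope /fl -q2 /fibsum big_map -(big_mkord xpredT (fun i => fib (q.+1 + 2 * i))) /index_iota subn0.
have ll1E : fibsum (map (addn (k - (g + 6))) l1) = fib q - v * lucas k.
  by rewrite l1E'; congr (fib _ - v * lucas _); rewrite /q /k; clear -hj; lia.
have le1 : v * lucas k <= fib q.
  apply: (@leq_trans (fib g * lucas k)); first by rewrite leq_mul2r vg orbT.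
  by apply: leq_trans (@fib_mul_lucas _ _ _) _; [rewrite /k; clear -hj; lia | apply: leq_fib; rewrite /q /r; clear; lia].
have ll2E : fibsum (map (addn (2 * k - (g + 6))) (a :: l2)) = w2 * lucas (2 * k).
  by rewrite l2E subnKC // /k; clear -hj; lia.
move: ll2E; rewrite /= {1}/fibsum big_cons -!/(fibsum _) -/p => ll2E.
(* The borrowed index [p] is absent: [l1] stays below [q], the filling runs through
   [q + 1, q + 3, ..., p - 1], and what is left of the upper block lies above [p + 1]. *)
pose L := ((l0 ++ map (addn (k - (g + 6))) l1) ++ fl) ++ map (addn (2 * k - (g + 6))) l2.
have zL : zlist L.
  apply: (zlist_cat (b := p.+1)).
  - apply: (zlist_cat (b := q)).
    + apply: (zlist_cat (b := g.+2)) => //; first exact: zlist_shift.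
      by apply/allP => _ /mapP[i /ge1 il ->]; rewrite /= /k; clear -hj il; lia.
    + exact: (@filler_zlist q.-2.+1).
    + rewrite all_cat; apply/andP; split.
        by apply: sub_all b0 => i; rewrite /q /r; lia.
      apply/allP => _ /mapP[i /(allP b1) il ->]; rewrite /= /q /k; move: il.
      by rewrite /= /k; lia.
    + by apply/allP => _ /mapP[i _ ->]; rewrite /= -q2; lia.
  - by apply: zlist_shift; apply/andP.
  - rewrite !all_cat -!andbA; apply/and3P; split.
    + by apply: sub_all b0 => i; rewrite /p /k; lia.
    + apply/allP => _ /mapP[i /(allP b1) il ->]; move: il; rewrite /= pE /q.
      by rewrite /= /k; lia.
    + apply/allP => _ /mapP[i hi ->]; move: hi.
      by rewrite mem_iota /= -q2 pE; lia.
  - by apply/allP => _ /mapP[i /a_l2 il ->]; rewrite /= /p; lia.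
have bL : all (fun i => i < 2 * k + g.+2) L.
  rewrite !all_cat -!andbA; apply/and4P; split.
  - by apply: sub_all b0 => i; clear; lia.
  - apply/allP => _ /mapP[i /(allP b1) il ->]; rewrite /= /r /k in il *.
    by clear -hj ab il; lia.
  - apply/allP => _ /mapP[i hi ->]; move: hi pE.
    by rewrite mem_iota /= -q2 /p; clear -hj ab; lia.
  - by apply/allP => _ /mapP[i /b2' il ->]; rewrite /= /k; clear -hj il; lia.
have [|l [zl _ lE sl]] := @append_blocks g k 2 L w wg _ zL bL D; first by rewrite /k; clear -hj; lia.
have -> : w0 + (w2 * lucas (2 * k) - v * lucas k) = fibsum L.
  rewrite /L !fibsum_cat e0 ll1E -ll2E flE.
  by move: le1; move: (v * _) (fib q) (fibsum fl) => ? ? ?; clear; lia.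
under eq_bigr do rewrite -add2n.
rewrite -lE sZ_zlist // sl /L !size_cat !size_map size_iota /s0.
by move: (\sum_(i < D) _) => ?; clear; lia.
Qed.

Local Open Scope ring_scope.

(** * Values of integer polynomials at large arguments *)

Lemma uniform_threshold (Q : nat -> nat -> Prop) n :
  (forall i, (i < n)%N -> exists c, forall u, (c <= u)%N -> Q i u) ->
  exists c, forall i, (i < n)%N -> forall u, (c <= u)%N -> Q i u.
Proof.
elim: n => [|n IHn] hQ; first by exists 0%N.
have [|c hc] := IHn; first by move=> i lt_in; apply: hQ; apply: ltnW.
have [c' hc'] := hQ n (ltnSn n); exists (maxn c c') => i; rewrite ltnS leq_eqVlt.
move=> /predU1P[->|lt_in] u; rewrite geq_max => /andP[cu c'u]; first exact: hc'.
exact: hc.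
Qed.

Lemma horner_nat_bound (p : {poly int}) n : (size p <= n.+1)%N ->
  exists C : nat, forall u : nat, (0 < u)%N -> `|p.[u%:Z]| <= (C * u ^ n)%N%:Z.
Proof.
move=> sp; exists (\sum_(i < n.+1) absz (p`_i)%R)%N => u u0.
rewrite (horner_coef_wide _ sp) PoszM (raddf_sum Posz) /= mulr_suml.
apply: le_trans (ler_norm_sum _ _ _) _; apply: ler_sum => i _.
rewrite normrM abszE ler_wpM2l // normrX ger0_norm // -!rmorphXn /= lez_nat.
by rewrite leq_pexp2l // -ltnS.
Qed.

(** A positive integer coefficient is at least 1, so the top term outweighs the rest once [u]
    exceeds the constant of [horner_nat_bound] for the lower terms. *)
Lemma horner_eventually_gt0 (p : {poly int}) n : (size p <= n.+1)%N ->
  0 < p`_n -> exists c : nat, forall u : nat, (c <= u)%N -> 0 < p.[u%:Z].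
Proof.
case: n => [|n] sp pn.
  by exists 0%N => u _; rewrite (size1_polyC sp) hornerC.
pose q : {poly int} := \poly_(i < n.+1) p`_i.
have pE : p = q + p`_n.+1 *: 'X^(n.+1).
  apply/polyP => i; rewrite coefD coef_poly coefZ coefXn.
  have [->|ne] := eqVneq i n.+1; first by rewrite ltnn add0r mulr1.
  rewrite mulr0 addr0; case: ltnP => // le_ni; apply/nth_default/(leq_trans sp).
  by rewrite ltn_neqAle eq_sym ne.
have [C hC] := horner_nat_bound (size_poly n.+1 (fun i => p`_i) : (size q <= _)%N).
exists C.+1 => u Cu; rewrite pE hornerD hornerZ hornerXn.
have u0 : (0 < u)%N by apply: leq_trans Cu.
have := hC u u0; rewrite ler_norml => /andP[h _].
have h2 : (C * u ^ n)%N%:Z < p`_n.+1 * u%:Z ^+ n.+1.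
  apply: (@lt_le_trans _ _ (u%:Z ^+ n.+1)); last by rewrite ler_peMl // exprn_ge0.
  by rewrite -rmorphXn /= ltz_nat natrXE expnS ltn_mul2r expn_gt0 u0.
by rewrite -ltrBlDl sub0r (le_lt_trans _ h2) // lerNl.
Qed.

(** * Palindromic polynomials and values at sums of Lucas numbers *)

(** Then [X ^ (- M) p] is invariant under inverting [X], hence an integer combination of 1 and the
    [X ^ j + X ^ (- j)]; at [X = alpha ^ k] with [k] even these become [L_{jk}]. *)
Definition palindromic M (p : {poly int}) :=
  (size p <= (2 * M).+1)%N /\ forall i, (i <= 2 * M)%N -> p`_(2 * M - i) = p`_i.

Lemma palindromic1 : palindromic 0 1.
Proof. by split=> [|i]; rewrite ?size_poly1 // leqn0 => /eqP->. Qed.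

Lemma palindromicM M N p q :
  palindromic M p -> palindromic N q -> palindromic (M + N) (p * q).
Proof.
move=> [sp pp] [sq pq]; split.
  apply: leq_trans (size_polyMleq _ _) _; move: sp sq; case: (size p) => [|a]; lia.
have pqE m : (p * q)`_m = \sum_(i < (2 * M).+1) \sum_(j < (2 * N).+1)
    p`_i * q`_j * (m == i + j)%N%:R.
  rewrite {1}(_ : p = \poly_(i < (2 * M).+1) p`_i); last first.
    by apply/polyP => i; rewrite coef_poly; case: ltnP => // h; apply/nth_default/(leq_trans sp).
  rewrite {1}(_ : q = \poly_(i < (2 * N).+1) q`_i); last first.
    by apply/polyP => i; rewrite coef_poly; case: ltnP => // h; apply/nth_default/(leq_trans sq).
  rewrite !poly_def big_distrlr /= coef_sum; apply: eq_bigr => i _.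
  rewrite coef_sum; apply: eq_bigr => j _.
  by rewrite -scalerAl -scalerAr scalerA -exprD coefZ coefXn.
move=> i hi; rewrite !pqE (reindex_inj rev_ord_inj) /=; apply: eq_bigr => a _.
rewrite (reindex_inj rev_ord_inj) /=; apply: eq_bigr => b _.
have ha : (a <= 2 * M)%N by rewrite -ltnS.
have hb : (b <= 2 * N)%N by rewrite -ltnS.
rewrite !subSS (pp _ ha) (pq _ hb); congr (_ * _%:R); congr nat_of_bool.
by apply/eqP/eqP; lia.
Qed.

Lemma palindromicX M p i : palindromic M p -> palindromic (M * i) (p ^+ i).
Proof.
move=> pp; elim: i => [|i IHi]; first by rewrite muln0; apply: palindromic1.
by rewrite mulnS exprS; apply: palindromicM.
Qed.

Lemma palindromic_horner (F : fieldType) M p (y : F) : palindromic M p -> y != 0 ->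
  (map_poly intr p).[y] = y ^+ M *
   ((p`_M)%:~R + \sum_(j < M) (p`_(M + j.+1))%:~R * (y ^+ j.+1 + y^-1 ^+ j.+1)).
Proof.
move=> [sp pp] y0.
have sp' : (size (map_poly intr p : {poly F}) <= M + M.+1)%N.
  by apply: leq_trans (size_poly _ _) _; apply: leq_trans sp _; lia.
rewrite (horner_coef_wide _ sp') big_split_ord big_ord_recl /= addn0.
rewrite mulrDr [y ^+ M * _%:~R]mulrC mulr_sumr addrCA; congr (_ + _).
  by rewrite coef_map_id0.
rewrite (reindex_inj rev_ord_inj) /= -big_split /=; apply: eq_bigr => j _.
rewrite !coef_map_id0 // /bump /= add1n.
have -> : p`_(M - j.+1) = p`_(M + j.+1).
  rewrite -[RHS]pp; last by have := ltn_ord j; lia.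
  by congr (p`_ _); have := ltn_ord j; lia.
rewrite addrC mulrCA !mulrDr -exprD; congr (_ * _ + _ * _).
by rewrite exprVn -expfB_cond ?(negPf y0) // add0n.
Qed.

(** The terms beyond [M] vanish; allowing any [D >= M] lets all powers of one polynomial share the
    same range of summation. *)
Lemma palindromic_lucas M D p k (t : int) (x : realalg) : golden x -> ~~ odd k ->
  palindromic M p -> (M <= D)%N ->
  (map_poly intr p).[(1 + x) ^+ k] = ((1 + x) ^+ k) ^+ M * t%:~R ->
  t = p`_M + \sum_(j < D) p`_(M + j.+1) * (lucas (j.+1 * k))%:Z.
Proof.
move=> gx ek pp MD; have y0 : (1 + x) ^+ k != 0.
  by case: gx => x0 _; rewrite expf_neq0 // lt0r_neq0 // addr_gt0.
rewrite (palindromic_horner pp y0) => /(mulfI (expf_neq0 _ y0)) tE.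
apply: (@intr_inj realalg); rewrite -tE rmorphD rmorph_sum /=; congr (_ + _).
rewrite -(subnKC MD) big_split_ord /= [RHS]addrC [X in _ = X + _]big1 ?add0r; last first.
  move=> i _; rewrite (nth_default 0) ?mul0r //.
  by case: pp => sp _; apply: leq_trans sp _; lia.
by apply: eq_bigr => j _; rewrite intrM -(lucas_even_mul gx) // -pmulrn.
Qed.

(* Coefficient of [X ^ j] in the Laurent polynomial [P (u + X ^ (- e) * q)], as
   a polynomial in [u]. *)
Definition laurent_coef e (q P : {poly int}) j : {poly int} :=
  \sum_(i < size P) (q ^+ i)`_(e * i + j) *: P^`N(i).

(** Taylor expansion of [P] at [u]: each [t ^+ i] is expanded in Lucas numbers through [q ^+ i], and
    the two sums are exchanged. *)
Lemma horner_laurent e (q P : {poly int}) d k (t u : int) (x : realalg) :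
  golden x -> ~~ odd k -> palindromic e q -> size P = d.+1 ->
  (map_poly intr q).[(1 + x) ^+ k] = ((1 + x) ^+ k) ^+ e * t%:~R ->
  P.[u + t] = (laurent_coef e q P 0).[u] +
    \sum_(j < e * d) (laurent_coef e q P j.+1).[u] * (lucas (j.+1 * k))%:Z.
Proof.
move=> gx ek pq sP qt.
have tE (i : 'I_(size P)) : t ^+ i = (q ^+ i)`_(e * i) +
    \sum_(j < e * d) (q ^+ i)`_(e * i + j.+1) * (lucas (j.+1 * k))%:Z.
  apply: (palindromic_lucas gx ek (palindromicX i pq)).
    by rewrite leq_mul2l -ltnS -sP ltn_ord orbT.
  by rewrite !rmorphXn /= horner_exp qt exprMn exprM.
rewrite (nderiv_taylor _ (mulrC _ _)) /laurent_coef.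
under eq_bigr do rewrite tE mulrDr mulr_sumr.
rewrite big_split /= exchange_big /=; congr (_ + _).
  by rewrite horner_sum; apply: eq_bigr => i _; rewrite hornerZ mulrC addn0.
apply: eq_bigr => j _; rewrite horner_sum mulr_suml; apply: eq_bigr => i _.
by rewrite hornerZ mulrCA mulrA.
Qed.

Lemma coef_laurent_coef e (q P : {poly int}) j n : (laurent_coef e q P j)`_n =
  \sum_(i < size P) (q ^+ i)`_(e * i + j) * (P`_(i + n) *+ 'C(i + n, i)).
Proof.
by rewrite coef_sum; apply: eq_bigr => i _; rewrite coefZ coef_nderivn.
Qed.

Lemma size_laurent_coef e (q P : {poly int}) j d : size P = d.+1 ->
  (size (laurent_coef e q P j) <= d.+1)%N.
Proof.
move=> sP; apply/leq_sizeP => n hn; rewrite coef_laurent_coef big1 // => i _.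
have -> : P`_(i + n) = 0 by apply: nth_default; apply: leq_trans (leq_addl _ _); rewrite {1}sP.
by rewrite mul0rn mulr0.
Qed.

Lemma laurent_coef_bound e (q P : {poly int}) d D : size P = d.+1 ->
  exists C : nat, forall j, (j < D)%N -> forall u : nat, (0 < u)%N ->
   `|(laurent_coef e q P j).[u%:Z]| <= (C * u ^ d)%N%:Z.
Proof.
(* The threshold supplied by [uniform_threshold] is here the constant [C] itself, since the bound
   persists when [C] grows. *)
move=> sP; pose Q j C := forall u : nat, (0 < u)%N ->
  `|(laurent_coef e q P j).[u%:Z]| <= (C * u ^ d)%N%:Z.
have [|C hC] := @uniform_threshold Q D; last by exists C => j jD; apply: (hC j jD C).
move=> j _; have [C hC] := horner_nat_bound (size_laurent_coef e q j sP).
exists C => C' CC' u u0; apply: le_trans (hC u u0) _.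
by rewrite lez_nat leq_mul2r CC' orbT.
Qed.

Lemma nderivn_eventually_ge0 (P : {poly int}) d : P \is monic -> size P = d.+1 ->
  exists c, forall i, (i < d.+1)%N -> forall u : nat, (c <= u)%N -> 0 <= P^`N(i).[u%:Z].
Proof.
move=> mP sP; apply: uniform_threshold => i; rewrite ltnS => id.
have [||c hc] := @horner_eventually_gt0 P^`N(i) (d - i).
- apply/leq_sizeP => n hn; rewrite coef_nderivn nth_default ?mul0rn // sP.
  by rewrite -(subnKC id) -addnS leq_add2l.
- rewrite coef_nderivn subnKC //; move/monicP: mP; rewrite lead_coefE sP /= => ->.
  by rewrite ltr0n bin_gt0.
by exists c => u cu; apply/ltW/hc.
Qed.

Lemma laurent_coef_ge0 e (q P : {poly int}) d : P \is monic -> size P = d.+1 ->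
  (forall i m, 0 <= (q ^+ i)`_m) ->
  exists c, forall j (u : nat), (c <= u)%N -> 0 <= (laurent_coef e q P j).[u%:Z].
Proof.
move=> mP sP q0; have [c hc] := nderivn_eventually_ge0 mP sP.
exists c => j u cu; rewrite horner_sum sumr_ge0 // => i _; rewrite hornerZ.
by rewrite mulr_ge0 // hc // -sP.
Qed.

(** For [i < i0] the degree of [q ^+ i] is too small to reach [e * i + j], and for [i > i0] the
    derivative has degree below [d - i0]; so the term [i0] alone decides the behaviour for large
    [u]. *)
Lemma laurent_coef_top e (q P : {poly int}) d j i0 : P \is monic -> size P = d.+1 ->
  (size q <= (2 * e).+1)%N -> (i0 <= d)%N -> (forall i, (i < i0)%N -> (e * i < j)%N) ->
  (size (laurent_coef e q P j) <= (d - i0).+1)%N /\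
  (laurent_coef e q P j)`_(d - i0) = (q ^+ i0)`_(e * i0 + j) *+ 'C(d, i0).
Proof.
move=> mP sP sq i0d hj.
have z1 i n : (d < i + n)%N -> P`_(i + n) *+ 'C(i + n, i) = 0.
  by move=> h; rewrite nth_default ?mul0rn // sP.
have z2 i : (i < i0)%N -> (q ^+ i)`_(e * i + j) = 0.
  move=> /hj h; rewrite nth_default //; apply: leq_trans (size_poly_exp_leq _ _) _.
  have : ((size q).-1 * i <= 2 * e * i)%N by rewrite leq_mul2r; apply/orP; right; lia.
  by rewrite -mulnA; move: h; move: (_.-1 * i)%N (e * i)%N => a b; lia.
split.
  apply/leq_sizeP => n hn; rewrite coef_laurent_coef big1 // => i _.
  have [lt|le] := ltnP i i0; first by rewrite z2 ?mul0r.
  by rewrite z1 ?mulr0 //; lia.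
have i0s : (i0 < size P)%N by rewrite sP ltnS.
rewrite coef_laurent_coef (bigD1 (Ordinal i0s)) //= big1 ?addr0 => [|i ne].
  rewrite subnKC //; move/monicP: mP; rewrite lead_coefE sP /= => ->.
  by rewrite mulrnAr mulr1.
have [lt|le|eq] := ltngtP i i0; first by rewrite z2 ?mul0r.
  by rewrite z1 ?mulr0 //; lia.
by case/eqP: ne; apply: val_inj.
Qed.

(** * Windows and borrows *)

(** [X] times [X + X ^ -1], which encodes the shift by [L_k]. *)
Definition window_poly : {poly int} := Poly [:: 1; 0; 1].
(* [X ^ 3] times [T = X ^ 3 + 2 X ^ 2 - X - X ^ -1 + 2 X ^ -2 + X ^ -3]: since
   [2 ^ 2 > 2 * 1 * 1], for [i >= 2] the three top coefficients
   [1, 2 i, i (2 i - 3)] of [T ^ i] are positive, so for large [u] the only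
   negative coefficient of [(u + T) ^ d] in nonnegative degree is that of [X]. *)
Definition borrow_poly : {poly int} := Poly [:: 1; 2; -1; 0; -1; 2; 1].

Lemma window_poly_palindromic : palindromic 1 window_poly.
Proof.
split=> [|i]; first exact: leq_trans (size_Poly _) _.
by rewrite !coef_Poly; case: i => [|[|[|i]]].
Qed.

Lemma borrow_poly_palindromic : palindromic 3 borrow_poly.
Proof.
split=> [|i]; first exact: leq_trans (size_Poly _) _.
by rewrite !coef_Poly; do 7![case: i => [//|i]].
Qed.

(** Naming the inverse [y] turns the evaluations below into ring identities modulo one relation. *)
Lemma golden_pow_unit (x : realalg) k : golden x -> ~~ odd k ->
  exists y : realalg, (1 + x) ^+ k * y = 1 /\
    forall j, (lucas (j * k))%:R = ((1 + x) ^+ k) ^+ j + y ^+ j.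
Proof.
move=> gx ek; exists ((1 + x) ^+ k)^-1; split; last by move=> j; apply: lucas_even_mul.
by case: gx => x0 _; rewrite mulfV // expf_neq0 // lt0r_neq0 // addr_gt0.
Qed.

Lemma window_poly_horner (x : realalg) k : golden x -> ~~ odd k ->
  (map_poly intr window_poly).[(1 + x) ^+ k] =
  ((1 + x) ^+ k) ^+ 1 * ((lucas k)%:Z)%:~R.
Proof.
move=> gx ek; have [y [xy lE]] := golden_pow_unit gx ek.
rewrite /window_poly map_Poly_id0 // horner_Poly /= -pmulrn; have := lE 1%N; rewrite mul1n => ->.
by move: (_ ^+ k) xy => X xy; ring: xy.
Qed.

Lemma borrow_poly_horner (x : realalg) k : golden x -> ~~ odd k ->
  (map_poly intr borrow_poly).[(1 + x) ^+ k] =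
  ((1 + x) ^+ k) ^+ 3 * ((lucas (3 * k) + 2 * lucas (2 * k))%:Z - (lucas k)%:Z)%:~R.
Proof.
move=> gx ek; have [y [xy lE]] := golden_pow_unit gx ek.
rewrite /borrow_poly map_Poly_id0 // horner_Poly /=.
have -> : ((lucas (3 * k) + 2 * lucas (2 * k))%:Z - (lucas k)%:Z)%:~R =
    (lucas (3 * k))%:R + 2 * (lucas (2 * k))%:R - (lucas (1 * k))%:R :> realalg.
  by rewrite mul1n intrB -!pmulrn natrD [(2 * _)%N%:R]natrM.
rewrite !lE; move: (_ ^+ k) xy => X xy; ring: xy.
Qed.

Lemma window_poly_exp_ge0 i m : 0 <= (window_poly ^+ i)`_m.
Proof.
elim: i m => [|i IHi] m; first by rewrite expr0 coef1; case: eqP.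
rewrite exprS coefM sumr_ge0 // => j _; rewrite mulr_ge0 //.
by rewrite coef_Poly; case: (nat_of_ord j) => [|[|[|[]]]].
Qed.

(** The low end is accessible to induction, and the palindromic symmetry carries it to the top
    coefficients. *)
Lemma borrow_poly_exp_coef i : [/\ (borrow_poly ^+ i)`_0 = 1,
  (borrow_poly ^+ i)`_1 = 2 * i%:Z & (borrow_poly ^+ i)`_2 = i%:Z * (2 * i%:Z - 3)].
Proof.
elim: i => [|i [IH0 IH1 IH2]]; first by rewrite expr0 !coef1.
rewrite exprS !coefM !big_ord_recr !big_ord0 /= IH0 IH1 IH2 !coef_Poly /=.
by rewrite intS; split; ring.
Qed.

Lemma sum_nonneg_Posz (w : nat -> int) (a : nat -> nat) D :
  (forall j, (j < D)%N -> 0 <= w j) ->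
  \sum_(j < D) w j * (a j)%:Z = (\sum_(j < D) absz (w j) * a j)%N%:Z.
Proof.
move=> h; rewrite (raddf_sum Posz); apply: eq_bigr => j _ /=.
by rewrite PoszM gez0_abs // h.
Qed.

(** The value depends on [u] and [g] but not on [k], so the windows at [lucas k] for all admissible
    even [k] coincide. *)
Lemma zeckendorf_seq_window (P : {poly int}) d : P \is monic -> size P = d.+1 ->
  exists C u0, forall g k u, ~~ odd k -> (2 * (g + 6) <= k)%N -> (u0 <= u)%N ->
   (C * u ^ d <= fib g)%N ->
   zeckendorf_seq P (lucas k + u) =
     (sZ (absz (laurent_coef 1 window_poly P 0).[u%:Z]) +
      \sum_(j < d) sZ (absz (laurent_coef 1 window_poly P j.+1).[u%:Z] * lucas (g + 6)))%:R.
Proof.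
move=> mP sP.
have [C hC] := laurent_coef_bound 1 window_poly d.+1 sP.
have [u0 hu] := laurent_coef_ge0 1 mP sP window_poly_exp_ge0.
have [x gx] := golden_exists realalg.
exists C, (maxn u0 1) => g k u ek gk; rewrite geq_max => /andP[u0u u1] Cu.
rewrite /zeckendorf_seq addnC PoszD.
rewrite (horner_laurent u%:Z gx ek window_poly_palindromic sP (window_poly_horner gx ek)).
rewrite mul1n (@sum_nonneg_Posz (fun j => (laurent_coef 1 window_poly P j.+1).[u%:Z])
  (fun j => lucas (j.+1 * k))) => [|j _]; last exact: hu.
rewrite -[(laurent_coef 1 window_poly P 0).[_]]gez0_abs ?hu // -PoszD !absz_nat.
have bd j : (j < d.+1)%N -> (absz (laurent_coef 1 window_poly P j).[u%:Z] <= fib g)%N.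
  move=> jd; apply: leq_trans Cu; rewrite -lez_nat abszE.
  exact: hC.
(* Extended by 0, because [sZ_blocks] wants the bound at every index. *)
pose w j := if (j < d)%N then absz (laurent_coef 1 window_poly P j.+1).[u%:Z] else 0%N.
have wg j : (w j <= fib g)%N by rewrite /w; case: ifP => // jd; apply: bd.
have := @sZ_blocks g k _ w d (bd 0%N isT) wg gk.
rewrite (eq_bigr (fun j : 'I_d => absz (laurent_coef 1 window_poly P j.+1).[u%:Z]
   * lucas (j.+1 * k))%N); last by move=> j _; rewrite /w ltn_ord.
by move=> ->; congr _%:R; congr addn; apply: eq_bigr => j _; rewrite /w ltn_ord.
Qed.

Lemma borrow_coef_sign (P : {poly int}) d j : P \is monic -> size P = d.+1 ->
  (j <= 3 * d)%N -> exists c, forall u : nat, (c <= u)%N ->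
  if j == 1%N then (laurent_coef 3 borrow_poly P j).[u%:Z] < 0
  else 0 < (laurent_coef 3 borrow_poly P j).[u%:Z].
Proof.
(* [i0] is [j / 3] rounded up, so [3 * i0 - j] is 0, 1 or 2 and one of the three known coefficients
   governs the sign; it is negative only for [i0 = 1] and difference 2, that is [j = 1]. *)
move=> mP sP jd; pose i0 := ((j + 2) %/ 3)%N.
have i0d : (i0 <= d)%N by rewrite /i0; lia.
have [|sW topW] := @laurent_coef_top 3 borrow_poly P d j i0 mP sP (proj1 borrow_poly_palindromic) i0d.
  by move=> i; rewrite /i0; lia.
have [c0 c1 c2] := borrow_poly_exp_coef i0.
have [_ pal] := palindromicX i0 borrow_poly_palindromic.
have topE : (borrow_poly ^+ i0)`_(3 * i0 + j) = (borrow_poly ^+ i0)`_(3 * i0 - j).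
  by rewrite -[LHS]pal; [congr (_`_ _) |]; rewrite /i0; lia.
have binp : (0 < 'C(d, i0))%N by rewrite bin_gt0.
have [j1|j1] := eqVneq j 1%N.
  have i01 : i0 = 1%N by rewrite /i0 j1.
  have [||c hc] := @horner_eventually_gt0 (- laurent_coef 3 borrow_poly P j) (d - i0).
  - by rewrite size_polyN.
  - rewrite coefN topW topE; have -> : (3 * i0 - j = 2)%N by rewrite i01 j1.
    rewrite c2 {1 2}i01 (_ : _ * _ = -1) // mulNrn opprK.
    by rewrite ltr0n.
  by exists c => u /hc; rewrite hornerN oppr_gt0.
apply: horner_eventually_gt0 sW _; rewrite topW topE pmulrn_lgt0 //.
have : [|| 3 * i0 - j == 0, (3 * i0 - j == 1) && (0 < i0) |
   (3 * i0 - j == 2) && (1 < i0)]%N by rewrite /i0; move/eqP: j1; lia.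
case/or3P=> [/eqP->|/andP[/eqP-> i01]|/andP[/eqP-> i01]]; rewrite ?c0 ?c1 ?c2 //.
  by rewrite mulr_gt0 // ltz_nat.
by rewrite mulr_gt0 ?ltz_nat //; lia.
Qed.

(** * Recurrences, periods and the lower bound for the complexity *)

Lemma lucas_double_bound a : exists K, forall n, (0 < n)%N ->
  (lucas (2 * n + a) <= K * fib n ^ 2)%N.
Proof.
have fib_add m b : (fib (m.+1 + b) <= 2 ^ b * fib m.+1)%N.
  elim: b => [|b IHb]; first by rewrite addn0 mul1n.
  rewrite addnS expnS -mulnA mul2n -addnn; apply: leq_trans (leq_add IHb IHb).
  by rewrite addSn fibSS leq_add2r; apply: leq_fib.
(* The 5 comes from [fib (2 n + 1) = fib n ^ 2 + fib n.+1 ^ 2] and [fib n.+1 <= 2 fib n]. *)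
exists (2 ^ a.+1 * 5)%N => n n0.
have an0 : (0 < 2 * n + a)%N by lia.
apply: leq_trans (lucas_le_fib _) _; rewrite eqn0Ngt an0 addn0.
have -> : ((2 * n + a).+2 = (2 * n).+1 + a.+1)%N by lia.
apply: leq_trans (fib_add _ _) _; rewrite -mulnA leq_mul2l; apply/orP; right.
have -> : ((2 * n).+1 = (n + n).+1)%N by lia.
rewrite fib_double -mulnn.
have : (fib n.+1 <= 2 * fib n)%N.
  by case: n n0 {an0} => // n _; rewrite fibSS mul2n -addnn leq_add2r leq_fib.
by move: (fib n) (fib n.+1) => b c; nia.
Qed.

Lemma recurrence_window (S : nat -> 'F_2) N m a b : satisfies_recurrence S N m ->
  (a <= b)%N -> (forall i, (i < m)%N -> S (a + i)%N = S (b + i)%N) ->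
  forall i, (b + i < N)%N -> S (a + i)%N = S (b + i)%N.
Proof.
case=> f hf ab hw; elim/ltn_ind => i IHi bi.
have [/hw//|mi] := ltnP i m.
rewrite -(subnK mi) !addnA !hf; try lia.
apply: meval_eq => j; rewrite -!addnA; apply: IHi; have := ltn_ord j; lia.
Qed.

Lemma lucas_periods (T : Type) (S : nat -> T) A N m :
  (forall n, (A <= n)%N -> (n + lucas m.+1 < N)%N -> S (n + lucas m.+1)%N = S n) ->
  (forall n, (A <= n)%N -> (n + lucas m.+3 < N)%N -> S (n + lucas m.+3)%N = S n) ->
  forall n, (A <= n)%N -> (n + lucas m.+1.+4 <= N)%N -> S n.+1 = S n.
Proof.
(* The descent goes forward by [lucas i.+2] and back by [lucas i.+1]. The range in [Q i] reproduces
   itself: using [Q i.+1] at [n + lucas i] needs exactly the bound of [Q i]. *)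
move=> p1 p3; pose Q i := forall n, (A <= n)%N ->
  (n + lucas m.+1.+4 < N + lucas i.+1)%N -> S (n + lucas i)%N = S n.
have lE i : lucas i.+2 = (lucas i + lucas i.+1)%N by [].
have Q1 : Q m.+1.
  move=> n An h; apply: p1 => //; move: h; rewrite !lE; lia.
have Q2 : Q m.+2.
  move=> n An h; rewrite -(p3 n) // -1?(p1 (n + lucas m.+2)%N); try by move: h; rewrite !lE; lia.
  by congr S; rewrite !lE; lia.
have step i : Q i.+1 -> Q i.+2 -> Q i.
  move=> q1 q2 n An h; rewrite -(q2 n) // -1?(q1 (n + lucas i)%N); try by move: h; rewrite !lE; lia.
  by congr S; rewrite !lE; lia.
have desc k : Q k.+1 -> Q k.+2 -> Q 1%N.
  by elim: k => // k IHk q2 q3; apply: IHk => //; apply: step.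
move=> n An h; rewrite -addn1; apply: (desc m Q1 Q2) => //.
by rewrite (leq_ltn_trans h) // -addn1 leq_add2l.
Qed.

(** This is [tau + U] with [k = 2 j], so that [k] is even and [j.+1] corresponds to [k + 2]. *)
Definition borrow_point U j :=
  (lucas (3 * (2 * j)) + 2 * lucas (2 * (2 * j)) - lucas (2 * j) + U)%N.

Lemma fib_le_lucas n : (fib n <= lucas n)%N.
Proof. by have := lucasE n; have := leq_fib (leqnSn n); lia. Qed.

(** For a fixed large [U], the digit sum grows by exactly one from [j] to [j.+1], so its parity
    flips. *)
Lemma zeckendorf_seq_borrow (P : {poly int}) d : P \is monic -> size P = d.+1 ->
  (2 <= d)%N -> exists U j0, forall j, (j0 <= j)%N ->
  zeckendorf_seq P (borrow_point U j.+1) != zeckendorf_seq P (borrow_point U j).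
Proof.
move=> mP sP hd; have [x gx] := golden_exists realalg.
have [U hU] := uniform_threshold (n := (3 * d).+1) (fun j => @borrow_coef_sign P d j mP sP).
pose W j := (laurent_coef 3 borrow_poly P j).[U%:Z].
have W1 : W 1%N < 0 by have := hU 1%N _ U (leqnn U); apply; lia.
have W0 j : (j <= 3 * d)%N -> j != 1%N -> 0 < W j.
  by move=> jd /negPf j1; have := hU j jd U (leqnn U); rewrite j1.
(* With [U] fixed the coefficients are constants, and [n < fib n.+2] bounds them all by [fib g]. *)
pose g := (\sum_(j < (3 * d).+1) absz (W j)).+2.
have Wg j : (j <= 3 * d)%N -> (absz (W j) <= fib g)%N.
  move=> jd; apply/ltnW/(leq_ltn_trans _ (ltn_fib _)).
  by rewrite (bigD1 (Ordinal (jd : (j < _.+1)%N))) //= leq_addr.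
pose D := (3 * d - 2)%N; have DE : (3 * d = D.+2)%N by rewrite /D; lia.
pose w i := if (i < D)%N then absz (W i.+3) else 0%N.
have wg i : (w i <= fib g)%N by rewrite /w; case: ifP => // iD; apply: Wg; lia.
have [||||||c hc] := @sZ_borrow g (absz (W 0%N)) (absz (W 1%N)) (absz (W 2%N)) w D.
- exact: Wg.
- by apply: Wg; lia.
- by apply: Wg; lia.
- exact: wg.
- by rewrite absz_gt0 ltr0_neq0.
- by rewrite absz_gt0 lt0r_neq0 // W0 //; lia.
have val j : (g + 6 <= j)%N -> zeckendorf_seq P (borrow_point U j) = (c + (j - (g + 6)))%N%:R.
  move=> hj; rewrite -hc // /zeckendorf_seq /borrow_point; set k := (2 * j)%N.
  have ek : ~~ odd k by rewrite /k mul2n odd_double.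
  have le_k : (lucas k <= lucas (3 * k) + 2 * lucas (2 * k))%N.
    by apply: leq_trans (leq_addr _ _); apply: leq_lucas; rewrite /k; lia.
  have le2 : (absz (W 1%N) * lucas k <= absz (W 2%N) * lucas (2 * k))%N.
    apply: (@leq_trans (fib g * lucas k)); first by rewrite leq_mul2r Wg ?orbT //; lia.
    apply: leq_trans (@fib_mul_lucas _ _ _) _; first by rewrite /k; lia.
    apply: (@leq_trans (lucas (2 * k))).
      by apply: leq_trans (fib_le_lucas _); apply: leq_fib; rewrite /k; lia.
    by apply: leq_pmull; rewrite absz_gt0 lt0r_neq0 // W0 //; lia.
  rewrite addnC PoszD -subzn //.
  rewrite (horner_laurent U%:Z gx ek borrow_poly_palindromic sP (borrow_poly_horner gx ek)).
  rewrite DE !big_ord_recl /= /bump /= mul1n.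
  rewrite (eq_bigr (fun i : 'I_D => (w i)%:Z * (lucas (i.+3 * k))%:Z)); last first.
    move=> i _; rewrite /w ltn_ord gez0_abs //; apply/ltW/W0 => //.
    by have := ltn_ord i; lia.
  have -> : \sum_(i < D) (w i)%:Z * (lucas (i.+3 * k))%:Z =
      (\sum_(i < D) w i * lucas (i.+3 * k))%N%:Z.
    by rewrite (raddf_sum Posz); apply: eq_bigr => i _ /=; rewrite PoszM.
  rewrite -!/(W _); congr (sZ _)%:R.
  rewrite -[RHS]absz_nat; congr (absz _).
  rewrite !PoszD -subzn // !PoszM.
  have W2 : 0 < W 2%N by apply: W0 => //; lia.
  rewrite (ltz0_abs W1) (gtz0_abs W2) gtz0_abs ?W0 //.
  by ring.
exists U, (g + 6)%N => j hj; rewrite !val //; last by apply: leqW.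
rewrite subSn // addnS; move: (c + _)%N => z.
by rewrite -natr1 -subr_eq0 addrC addKr oner_neq0.
Qed.

Lemma borrow_point_bounds U j : (0 < j)%N ->
  (lucas (6 * j) <= borrow_point U j <= 3 * lucas (6 * j) + U)%N.
Proof.
move=> j0; rewrite /borrow_point; have -> : (3 * (2 * j) = 6 * j)%N by lia.
have : (lucas (2 * j) <= lucas (2 * (2 * j)))%N by apply: leq_lucas; lia.
have : (lucas (2 * (2 * j)) <= lucas (6 * j))%N by apply: leq_lucas; lia.
by move: (lucas _) (lucas _) (lucas _) => a b c; lia.
Qed.

(** The bound by [fib (3 * r)] puts a window of length [m] within reach of [zeckendorf_seq_window]
    for [g = 3 r]. For larger [N] the resulting constant range would contain two consecutive borrow
    points. *)
Lemma recurrence_length_bound (P : {poly int}) d : P \is monic -> size P = d.+1 ->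
  (2 <= d)%N -> exists C u0 r0, forall r N m, (r0 <= r)%N ->
    (C * (u0 + m) ^ d <= fib (3 * r))%N ->
    satisfies_recurrence (zeckendorf_seq P) N m -> (N < lucas (6 * r + 28))%N.
Proof.
move=> mP sP hd; have [C [u0 hw]] := zeckendorf_seq_window mP sP.
have [U [j0 hb]] := zeckendorf_seq_borrow mP sP hd.
exists C, u0, (j0 + u0 + U)%N => r N m hr Cm rec; rewrite ltnNge; apply/negP => hN.
(* [K = 2 (g + 6)] for [g = 3 r], the least [k] that the window statement admits. *)
set S := zeckendorf_seq P in hw hb rec *; pose K := (6 * r + 12)%N.
have eK : ~~ odd K by rewrite /K oddD oddM.
have win k k' i : ~~ odd k -> ~~ odd k' -> (K <= k)%N -> (K <= k')%N -> (i < m)%N ->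
    S (lucas k + u0 + i)%N = S (lucas k' + u0 + i)%N.
  move=> ek ek' Kk Kk' im.
  have Ci : (C * (u0 + i) ^ d <= fib (3 * r))%N.
    by apply: leq_trans Cm; rewrite leq_mul2l leq_exp2r ?leq_add2l 1?ltnW ?orbT //; lia.
  rewrite -!addnA (hw (3 * r)%N k) ?(hw (3 * r)%N k') ?leq_addr //; move: Kk Kk'; rewrite /K; lia.
have lE i : lucas i.+2 = (lucas i + lucas i.+1)%N by [].
have per k : ~~ odd k -> (K <= k)%N -> forall n, (lucas k + u0 <= n)%N ->
    (n + lucas k.+1 < N)%N -> S (n + lucas k.+1)%N = S n.
  move=> ek Kk n hn nN.
  have ab : (lucas k + u0 <= lucas k.+2 + u0)%N by rewrite leq_add2r lE leq_addr.
  have wk i : (i < m)%N -> S (lucas k + u0 + i)%N = S (lucas k.+2 + u0 + i)%N.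
    by move=> im; apply: win => //=; [rewrite negbK | lia].
  have := recurrence_window rec ab wk (i := n - (lucas k + u0)).
  rewrite subnKC // lE; have -> : (lucas k + lucas k.+1 + u0 + (n - (lucas k + u0)) = n + lucas k.+1)%N by lia.
  by move=> /(_ nN).
(* From [A] on both periods [lucas K.+1] and [lucas K.+3] are available. *)
pose A := (lucas K.+2 + u0)%N.
have step : forall n, (A <= n)%N -> (n + lucas K.+1.+4 <= N)%N -> S n.+1 = S n.
  apply: lucas_periods => n An; apply: per => //=; rewrite ?negbK //; try lia.
  by apply: leq_trans An; rewrite /A lE; lia.
have const x : (A <= x)%N -> (x + lucas K.+1.+4 <= N)%N -> S x = S A.
  move=> Ax; rewrite -(subnKC Ax); elim: (x - A)%N => [|t IHt]; first by rewrite addn0.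
  rewrite addnS => h; rewrite step ?leq_addr //; last by move: h; lia.
  by apply: IHt; move: h; lia.
(* These two points lie between [L_{6r+18}], which exceeds [A], and [3 L_{6r+24} + U]; adding the
   margin [L_{6r+17}] still stays below [L_{6r+28}]. *)
have inA j : (r + 3 <= j <= r + 4)%N -> S (borrow_point U j) = S A.
  move=> /andP[j3 j4]; have j_gt0 : (0 < j)%N by lia.
  have /andP[h1 h2] := borrow_point_bounds U j_gt0.
  have h3 : (lucas (6 * r + 18) <= lucas (6 * j))%N by apply: leq_lucas; lia.
  have h4 : (lucas (6 * j) <= lucas (6 * r + 24))%N by apply: leq_lucas; lia.
  apply: const.
    rewrite /A /K; apply: leq_trans h1; apply: leq_trans h3.
    have h5 : (u0 <= lucas (6 * r + 14).+1)%N by apply: leq_trans (leq_lucas_id _); lia.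
    have -> : (6 * r + 18 = (6 * r + 14).+4)%N by lia.
    have -> : ((6 * r + 12).+2 = 6 * r + 14)%N by lia.
    by move: (6 * r + 14)%N h5 => n h5; rewrite !lE; lia.
  apply: leq_trans hN; have := leq_lucas_id (6 * r + 24).
  have : (lucas K.+1.+4 <= lucas (6 * r + 24))%N by apply: leq_lucas; rewrite /K; lia.
  have -> : lucas (6 * r + 28) = (3 * lucas (6 * r + 25) + 2 * lucas (6 * r + 24))%N.
    have -> : (6 * r + 28 = (6 * r + 24).+4)%N by lia.
    have -> : (6 * r + 25 = (6 * r + 24).+1)%N by lia.
    by move: (6 * r + 24)%N => n; rewrite !lE; lia.
  have : (lucas (6 * r + 24) <= lucas (6 * r + 25))%N by apply: leq_lucas; lia.
  by move: h2 h4; lia.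
have r3 : (j0 <= r + 3)%N by lia.
by have := hb _ r3; rewrite !inA ?eqxx //; lia.
Qed.

(** Take the least admissible [r]: minimality bounds the previous [fib (3 * r)] by a multiple of
    [m ^ d], while [N] is at most a multiple of its square. This squaring produces the exponent
    [2 * d]. *)
Lemma max_order_complexity_bound (P : {poly int}) d : P \is monic -> size P = d.+1 ->
  (2 <= d)%N -> exists C N0, forall N, (N0 <= N)%N ->
    (N <= C * max_order_complexity (zeckendorf_seq P) N ^ (2 * d))%N.
Proof.
move=> mP sP hd; have [C [u0 [r0 hr]]] := recurrence_length_bound mP sP hd.
have [U [j0 hb]] := zeckendorf_seq_borrow mP sP hd.
have [K hK] := lucas_double_bound 34.
exists (K * (C * u0.+1 ^ d) ^ 2)%N.
exists (lucas (6 * r0.+1 + 28) + (borrow_point U j0.+1 + borrow_point U j0).+2)%N => N hN.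
rewrite /max_order_complexity; case: forallP => [cst|_].
  (* A constant prefix is impossible, since [N] was taken large enough for it to contain two borrow
     points with different values. *)
  have cst' n : (n < N.-1)%N -> zeckendorf_seq P n = zeckendorf_seq P 0.
    by move=> h; have /eqP := cst (Ordinal h).
  by have /eqP[] := hb j0 (leqnn _); rewrite (cst' (borrow_point U j0.+1)) ?(cst' (borrow_point U j0)) //; lia.
case: ex_minnP => m /andP[m0 /asboolP rec] _.
pose X := (C * (u0 + m) ^ d)%N.
have ex : exists s, (X <= fib (3 * (r0.+1 + s)))%N.
  exists X.+2; apply: leq_trans (ltnW (ltn_fib X)) _; apply: leq_fib; lia.
case: (ex_minnP ex) => -[|s] Xs smin.
  (* If already the first index works, [N] falls below the chosen threshold. *)
  have := hr _ _ _ (leq_trans (leqnSn _) (leq_addr _ _)) Xs rec.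
  by rewrite addn0 => h; move: hN h; lia.
have Xn : (fib (3 * (r0.+1 + s)) < X)%N.
  by rewrite ltnNge; apply/negP => /smin; rewrite ltnn.
have r0s : (r0 <= r0.+1 + s.+1)%N by lia.
have /ltnW Nle := hr _ _ _ r0s Xs rec.
apply: leq_trans Nle _.
have -> : (6 * (r0.+1 + s.+1) + 28 = 2 * (3 * (r0.+1 + s)) + 34)%N by lia.
apply: leq_trans (hK _ _) _; first by lia.
rewrite -mulnA leq_mul2l; apply/orP; right.
rewrite [(2 * d)%N]mulnC expnM -expnMn leq_exp2r // (leq_trans (ltnW Xn)) //.
(* What remains is [u0 + m <= u0.+1 * m], which holds as [m] is positive. *)
rewrite /X -mulnA -expnMn leq_mul2l leq_exp2r; last by lia.
by apply/orP; right; nia.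
Qed.

Theorem theorem1p2 (R : realType) (d : nat) (P : {poly int})
    (hd : (2 <= d)%N) (hmonic : P \is monic) (hdeg : size P = d.+1)
    (hP : forall n : nat, 0 <= P.[n%:Z]) :
  exists2 c : R, 0 < c &
    exists N0 : nat, forall N : nat, (N0 <= N)%N ->
      c * (N%:R `^ (2 * d)%:R^-1) <=
        (max_order_complexity (zeckendorf_seq P) N)%:R.
Proof.
have [C [N0 hC]] := max_order_complexity_bound hmonic hdeg hd.
pose e : R := (2 * d)%:R^-1.
have d0 : (2 * d)%:R != 0 :> R by rewrite pnatr_eq0; lia.
have e0 : 0 <= e by rewrite invr_ge0 ler0n.
(* [C.+1] replaces [C] to have a positive number to divide by. *)
have c0 : 0 < C.+1%:R `^ e :> R by rewrite powR_gt0 ?ltr0n.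
exists (C.+1%:R `^ e)^-1; first by rewrite invr_gt0.
exists N0 => N /hC hN; rewrite mulrC ler_pdivrMr // mulrC.
set m := max_order_complexity _ _ in hN *.
apply: (@le_trans _ _ ((C.+1 * m ^ (2 * d))%N%:R `^ e)).
  apply: ge0_ler_powR; rewrite ?nnegrE ?ler0n ?ler_nat //.
  by apply: leq_trans hN _; rewrite leq_mul2r leqnSn orbT.
rewrite natrM powRM ?ler0n // natrX -powR_mulrn ?ler0n //.
by rewrite -powRrM mulfV // powRr1.
Qed.
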